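(* Let $n\ge 1$ and let $W$ be a Coxeter group with Coxeter generators $s_1,\dots,s_n$ and Coxeter matrix $(m_{ij})_{1\le i,j\le n}$ all of whose entries are finite. Let $\rho: W\to GL(V)$ be a faithful representation of $W$ on a finite-dimensional complex vector space $V$, and let $U=\sigma_p(\rho(s_1),\dots,\rho(s_n))\subseteq\mathbb{C}^n$ be its proper joint spectrum relative to $s_1,\dots,s_n$. Then the Coxeter group $W$ is determined by the set $U$, in the following sense: if $W'$ is another Coxeter group with Coxeter generators $s'_1,\dots,s'_n$ and Coxeter matrix $(m'_{ij})_{1\le i,j\le n}$ all of whose entries are finite, and if $\rho'$ is a faithful finite-dimensional complex representation of $W'$ with $\sigma_p(\rho'(s'_1),\dots,\rho'(s'_n))=U$, then $m_{ij}=m'_{ij}$ for all $1\le i,j\le n$.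
   Context: A Coxeter matrix $(m_{ij})_{1\le i,j\le n}$ is a symmetric matrix with entries in $\mathbb{N}\cup\{\infty\}$, $m_{ii}=1$ for all $i$ and $m_{ij}>1$ for $i\ne j$. The associated Coxeter group is $W=\langle s_1,\dots,s_n \mid (s_is_j)^{m_{ij}}=1 \text{ for all } i,j \text{ with } m_{ij}<\infty\rangle$. Only Coxeter groups with all $m_{ij}$ finite are considered (the group $W$ itself may be infinite). For linear operators $A_1,\dots,A_n$ on a finite-dimensional complex vector space, the proper joint spectrum is $$\sigma_p(A_1,\dots,A_n)=\{(x_1,\dots,x_n)\in\mathbb{C}^n : -I+x_1A_1+\dots+x_nA_n \text{ is not invertible}\}.$$ *)

(* Defs.v *)
From HB Require Import structures.
From mathcomp Require Import all_boot all_order all_algebra.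
From mathcomp Require Import complex.
From mathcomp Require Import classical_sets reals.

Set Implicit Arguments.
Unset Strict Implicit.
Unset Printing Implicit Defensive.

Import GRing.Theory.
Local Open Scope ring_scope.

(* Words in the letters x and x^-1 (x : I): (x, false) is the letter x and
   (x, true) is the letter x^-1. *)
Definition group_word (I : Type) : Type := seq (I * bool).

Definition letter_val (I : Type) (G : groupType) (s : I -> G)
    (l : I * bool) : G :=
  (if l.2 then (s l.1)^-1 else s l.1)%g.

Definition word_val (I : Type) (G : groupType) (s : I -> G)
    (w : group_word I) : G :=
  (\prod_(l <- w) letter_val s l)%g.

(* Equality of two words in the group < I | r = 1 for r in rel >. *)
Inductive pres_eq (I : Type) (rel : group_word I -> Prop) :
    group_word I -> group_word I -> Prop :=
| pres_refl u : pres_eq rel u u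
| pres_sym u v : pres_eq rel u v -> pres_eq rel v u
| pres_trans u v w : pres_eq rel u v -> pres_eq rel v w -> pres_eq rel u w
| pres_cancel u v i b :
    pres_eq rel (u ++ [:: (i, b); (i, ~~ b)] ++ v) (u ++ v)
| pres_relator u v r : rel r -> pres_eq rel (u ++ r ++ v) (u ++ v).

(* The canonical map from < I | r = 1 for r in rel > to G sending each
   generator i to s i is a well-defined isomorphism. *)
Definition has_presentation (I : Type) (G : groupType) (s : I -> G)
    (rel : group_word I -> Prop) : Prop :=
  (forall g : G, exists u, g = word_val s u) /\
  (forall u v, word_val s u = word_val s v <-> pres_eq rel u v).

(* Entries are natural numbers: only finite Coxeter matrices are considered. *)
Definition coxeter_matrix (n : nat) (m : 'M[nat]_n) : Prop :=
  [/\ forall i j, m i j = m j i,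
      forall i, m i i = 1%N
    & forall i j, i != j -> (1 < m i j)%N].

Definition coxeter_relator (n : nat) (m : 'M[nat]_n) (w : group_word 'I_n) :
    Prop :=
  exists i j, w = flatten (nseq (m i j) [:: (i, false); (j, false)]).

Definition coxeter_group (n : nat) (m : 'M[nat]_n) (W : groupType)
    (s : 'I_n -> W) : Prop :=
  coxeter_matrix m /\ has_presentation s (coxeter_relator m).

(* Each rho g is automatically invertible, with inverse rho g^-1, so rho is a
   group morphism from G to GL(V). *)
Definition representation (K : fieldType) (V : vectType K) (G : groupType)
    (rho : G -> 'End(V)) : Prop :=
  rho 1%g = \1%VF /\ (forall g h : G, rho (g * h)%g = (rho g \o rho h)%VF).

Definition faithful_representation (K : fieldType) (V : vectType K)
    (G : groupType) (rho : G -> 'End(V)) : Prop :=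
  representation rho /\ injective rho.

Definition lfun_invertible (K : fieldType) (V : vectType K) (f : 'End(V)) :
    Prop :=
  exists g : 'End(V), (f \o g)%VF = \1%VF /\ (g \o f)%VF = \1%VF.

Definition proper_joint_spectrum (K : fieldType) (V : vectType K) (n : nat)
    (A : 'I_n -> 'End(V)) : set 'rV[K]_n :=
  [set x : 'rV[K]_n |
    ~ lfun_invertible (- \1%VF + \sum_(i < n) x 0 i *: A i)]%classic.

(* Main.v *)
Require Import Defs.
From HB Require Import structures.
From mathcomp Require Import all_boot all_order all_algebra.
From mathcomp Require Import cyclic separable algC cyclotomic.
From mathcomp Require Import complex.
From mathcomp Require Import classical_sets reals.
From mathcomp Require Import ring.

Import GRing.Theory Num.Theory.

Local Open Scope ring_scope.

(** Only pairs of generators matter. For [i != j], the points of the joint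
spectrum supported on the coordinates [i] and [j] form the joint spectrum of
the two involutions [A = rho (s i)] and [B = rho (s j)], and they determine the
eigenvalues of the rotation [A B] up to inversion. Indeed, an eigenvalue [z] of
[A B] gives an [A]- and [B]-stable space of dimension at most two on which
[x A + y B] has square [x^2 + y^2 + x y (z + z^-1)], so that [z] is seen on the
conic [x^2 + y^2 + x y (z + z^-1) = 1]. Two of these conics with different
values of [z + z^-1] meet only where [x y = 0]; hence one well-chosen point
with [x y != 0] on the conic of [z] is enough to recognize [z] or [z^-1] as an
eigenvalue (lemmas [fixed_vector_of_eigenvector] and
[eigenvector_of_fixed_vector]).

An operator of finite order over an algebraically closed field of
characteristic zero is diagonalizable, so its order is determined by its
eigenvalues ([iter_eq1_of_eigenvalues]). Equal spectra thus force [A B] and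
[A' B'] to have the same order, which by faithfulness is the order of [s i * s j]
and of [s' i * s' j].

It remains to know that [s i * s j] has order exactly [m i j], and not a proper
divisor of it ([coxeter_relation_dvd]). This is proved with a linear action of
the Coxeter group generated by reflections. The usual real symmetric form
[- cos (pi / m i j)] is replaced by a Cartan matrix with off-diagonal entries
[- (1 + z i j)], where [z i j] is a primitive root of unity of order [m i j] and
[z j i = (z i j)^-1]: the products [(1 + z) (1 + z^-1)] are Galois conjugate to
the usual [4 cos^2 (pi / m)], and the eigenvectors of the product of two
reflections become explicit. *)

(** * Roots of unity and operators of finite order *)

Lemma closed_prim_root_exists (K : numClosedFieldType) (N : nat) :
  (0 < N)%N -> exists z : K, N.-primitive_root z.
Proof.
move=> N_gt0; have [r] := closed_field_poly_normal ('X^N - 1 : {poly K}).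
rewrite (monicP (monicXnsubC _ _)) // scale1r => Dr.
suff /hasP[z _ prim_z] : has N.-primitive_root r by exists z.
apply: has_prim_root => //.
- by apply/allP=> z; rewrite -root_prod_XsubC -Dr.
- by rewrite -separable_prod_XsubC -Dr separable_Xn_sub_1 // pnatr_eq0 -lt0n.
- by rewrite -ltnS -(size_prod_XsubC r id) -Dr size_XnsubC.
Qed.

Lemma geometric_sum_eq0 {K : fieldType} {N : nat} {z : K} :
  z ^+ N = 1 -> z != 1 -> \sum_(l < N) z ^+ l = 0.
Proof.
move=> zN1 z_neq1; apply: (mulfI (x := z - 1)); first by rewrite subr_eq0.
by rewrite mulr0 -subrX1 zN1 subrr.
Qed.

Lemma iter_eigenvector {K : fieldType} {V : lmodType K} (M : {linear V -> V})
    {z : K} {v : V} (k : nat) :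
  M v = z *: v -> iter k M v = z ^+ k *: v.
Proof.
move=> Mv; elim: k => [|k IHk]; first by rewrite scale1r.
by rewrite iterS IHk linearZ /= Mv scalerA exprSr.
Qed.

(** The discrete Fourier transform along the powers of [M] writes every vector
as a sum of eigenvectors of [M], on each of which [M ^ k] is the identity. *)
Lemma iter_eq1_of_eigenvalues {K : numClosedFieldType} {V : lmodType K}
    {M : {linear V -> V}} {N : nat} (k : nat) :
    (0 < N)%N -> (forall v, iter N M v = v) ->
    (forall z v, v != 0 -> M v = z *: v -> z ^+ k = 1) ->
  forall v, iter k M v = v.
Proof.
move=> N_gt0 MN1 eig_k v.
have [z prim_z] := closed_prim_root_exists K N N_gt0.
have zN1 : z ^+ N = 1 := prim_expr_order prim_z.
have z_neq0 : z != 0 by rewrite (prim_root_eq0 prim_z) -lt0n.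
pose p (i : nat) : V := \sum_(j < N) (z ^+ i) ^+ j *: iter j M v.
(* [p i] is the component of [N *: v] for the eigenvalue [z ^- i]; applying [M]
   shifts the sum cyclically. *)
have Mp i : M (p i) = (z ^+ i)^-1 *: p i.
  apply: (canRL (scalerK (expf_neq0 i z_neq0))).
  rewrite linear_sum scaler_sumr /p.
  case: N {N_gt0 prim_z p} MN1 zN1 => [|N] MN1 zN1; first by rewrite !big_ord0.
  rewrite big_ord_recr [in RHS]big_ord_recl [RHS]addrC; congr (_ + _).
    by apply: eq_bigr => j _; rewrite linearZ /= scalerA -exprS.
  by rewrite linearZ /= scalerA -exprS -iterS MN1 /= expr0 exprAC zN1 expr1n.
have kp i : iter k M (p i) = p i.
  have [-> | p_neq0] := eqVneq (p i) 0.
    by rewrite (iter_eigenvector M (z := 0)) ?linear0 ?scaler0.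
  by rewrite (iter_eigenvector M k (Mp i)) (eig_k _ _ p_neq0 (Mp i)) scale1r.
have sum_p : \sum_(i < N) p i = N%:R *: v.
  rewrite exchange_big /= (bigD1 (Ordinal N_gt0)) //= [X in _ + X]big1 => [|j j_neq0].
    rewrite (eq_bigr (fun=> v)) => [|i _]; last by rewrite scale1r.
    by rewrite sumr_const card_ord addr0 scaler_nat.
  rewrite -scaler_suml.
  under eq_bigr => i _ do rewrite exprAC.
  rewrite geometric_sum_eq0 ?scale0r //.
    by rewrite exprAC zN1 expr1n.
  by rewrite -(prim_order_dvd prim_z) gtnNdvd // lt0n.
have iterZ c : iter k M (c *: v) = c *: iter k M v.
  by elim: k {kp eig_k} => //= k ->; rewrite linearZ.
have iter_sum : iter k M (\sum_(i < N) p i) = \sum_(i < N) iter k M (p i).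
  by elim: k {kp eig_k iterZ} => //= k ->; rewrite linear_sum.
apply: (scalerI (a := N%:R)); first by rewrite pnatr_eq0 -lt0n.
rewrite -iterZ -sum_p iter_sum; exact: eq_bigr.
Qed.

(** * Pairs of involutions *)

(** On the span of [v] and [A v], [x A + y B] exchanges the two lines, with
product of the coefficients [(x + y z) (x + y / z)], which is [1] on the conic.
So [c *: v + A v] with [c = x + y / z] is fixed, and [c *: v - A v] is sent to
its opposite. When [A v] and [v] are proportional one of them may vanish, but
not both: this is why the conclusion allows the opposite point of the conic. *)
Lemma fixed_vector_of_eigenvector {K : numClosedFieldType} {V : lmodType K}
    {A B : {linear V -> V}} {z x y : K} {v : V} :
    involutive A -> involutive B -> z != 0 -> v != 0 ->
    A (B v) = z *: v -> x ^+ 2 + y ^+ 2 - 1 + x * y * (z + z^-1) = 0 ->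
  exists2 e : K, (e == 1) || (e == -1) &
    exists2 u, u != 0 & (e * x) *: A u + (e * y) *: B u = u.
Proof.
move=> AK BK z_neq0 v_neq0 ABv xyz.
have Bv : B v = z *: A v by rewrite -[B v]AK ABv linearZ.
have BAv : B (A v) = z^-1 *: v.
  by apply: (scalerI z_neq0); rewrite -linearZ /= -Bv BK scalerA mulfV ?scale1r.
pose c := x + y / z.
have cE : (x + y * z) * c = 1.
  by apply/eqP; rewrite -subr_eq0 -xyz /c; apply/eqP; field.
have fixed (e : K) : e * e = 1 ->
    (e * x) *: A (c *: v + e *: A v) + (e * y) *: B (c *: v + e *: A v)
    = c *: v + e *: A v.
  move=> ee; rewrite !linearD !linearZ /= AK Bv BAv.
  rewrite !scalerA addrACA -!scalerDl addrC.
  congr (_ *: _ + _ *: _).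
    by rewrite -[RHS]mul1r -ee /c; ring.
  by rewrite -[RHS]mulr1 -cE; ring.
have [u0 | u_neq0] := eqVneq (c *: v + 1 *: A v) 0; last first.
  by exists 1; rewrite ?eqxx //; exists (c *: v + 1 *: A v); rewrite ?fixed ?mulr1.
exists (-1); rewrite ?eqxx ?orbT //.
exists (c *: v + (-1) *: A v); last by rewrite fixed // mulrNN mulr1.
apply: contraNneq v_neq0 => u1.
have : 2 *: A v = 0.
  transitivity ((c *: v + 1 *: A v) - (c *: v + (-1) *: A v)).
    by rewrite opprD addrACA subrr add0r -scalerBl opprK.
  by rewrite u0 u1 subr0.
move/eqP; rewrite scaler_eq0 pnatr_eq0 /= => /eqP Av0.
by rewrite -[v]AK Av0 linear0.
Qed.

(** Squaring [x A + y B] shows that [A B + B A] acts on [u] by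
[(1 - x^2 - y^2) / (x y) = z + z^-1]. As [B A] is the inverse of [A B], this
reads [(A B - z) (A B - z^-1) u = 0], so either [u] or [(A B - z^-1) u] is an
eigenvector of [A B]. *)
Lemma eigenvector_of_fixed_vector {K : fieldType} {V : lmodType K}
    {A B : {linear V -> V}} {z x y : K} {u : V} :
    involutive A -> involutive B -> z != 0 -> x != 0 -> y != 0 -> u != 0 ->
    x *: A u + y *: B u = u -> x ^+ 2 + y ^+ 2 - 1 + x * y * (z + z^-1) = 0 ->
  exists2 w, w != 0 & (A (B w) = z *: w) \/ (A (B w) = z^-1 *: w).
Proof.
move=> AK BK z_neq0 x_neq0 y_neq0 u_neq0 fix_u xyz.
have BAu : B (A u) = (z + z^-1) *: u - A (B u).
  have xy_neq0 : x * y != 0 by rewrite mulf_neq0.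
  apply: (canRL (addrK _)); apply: (scalerI xy_neq0).
  have Au : A u = x *: u + y *: A (B u).
    by rewrite -{1}fix_u linearD !linearZ /= AK.
  have Bu : B u = x *: B (A u) + y *: u.
    by rewrite -{1}fix_u linearD !linearZ /= BK.
  have sq_u : x *: (x *: u + y *: A (B u)) + y *: (x *: B (A u) + y *: u) = u.
    by rewrite -Au -Bu.
  have -> : (x * y) *: ((z + z^-1) *: u) = u - (x ^+ 2 + y ^+ 2) *: u.
    rewrite -[X in X - _]scale1r -scalerBl scalerA; congr (_ *: _).
    by apply/eqP; rewrite -subr_eq0 -xyz; apply/eqP; ring.
  rewrite -[X in _ = X - _]sq_u scalerDl !scalerDr !scalerA -!expr2 [y * x]mulrC.
  by rewrite [x ^+ 2 *: u + _]addrC addrACA addrK addrC.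
pose w := A (B u) - z^-1 *: u.
have [w0 | w_neq0] := eqVneq w 0.
  by exists u => //; right; apply/eqP; rewrite -subr_eq0; apply/eqP.
exists w => //; left.
have BAw : B (A w) = z^-1 *: w.
  rewrite /w !linearB !linearZ /= AK BK BAu opprB scalerBr !scalerA mulrDr.
  by rewrite mulVf // scalerDl scale1r scalerN addrCA opprD [u + _]addrA subrr add0r.
apply: (scalerI (invr_neq0 z_neq0)).
by rewrite -linearZ /= -[X in A X]linearZ -BAw BK AK scalerA mulVf ?scale1r.
Qed.


(** Fixing [x = 2] makes the constant term [x^2 - 1 = 3] of the equation in [y]
nonzero, hence [y != 0], for every value of [t]. *)
Lemma conic_point {K : numClosedFieldType} (t : K) :
  exists2 y : K, y != 0 & 2 ^+ 2 + y ^+ 2 - 1 + 2 * y * t = 0.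
Proof.
have [y Dy] := @GRing.solve_monicpoly K 2 (nth 0 [:: -3; - 2 * t]) isT.
move: Dy; rewrite !big_ord_recl big_ord0 /= => Dy.
have yE : 2 ^+ 2 + y ^+ 2 - 1 + 2 * y * t = 0 by rewrite Dy; ring.
exists y => //; apply: contra_eq_neq yE => ->.
by rewrite expr0n mulr0 mul0r !addr0 (_ : _ - 1 = 3%:R) ?pnatr_eq0 //; ring.
Qed.

(** The fixed vectors of [x A + y B] for nonzero [x], [y] detect the eigenvalues of
[A B] up to inversion, and [z] and [z^-1] have the same [k]-th power condition;
so the order of [A B] is a multiple of that of [A' B']. *)
Lemma iter_eq1_of_fixed_vectors {K : numClosedFieldType} {V V' : lmodType K}
    {A B : {linear V -> V}} {A' B' : {linear V' -> V'}} {N k : nat} :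
    involutive A -> involutive B -> involutive A' -> involutive B' ->
    (0 < N)%N -> (forall v, iter N (A' \o B') v = v) ->
    (forall x y, (exists2 u, u != 0 & x *: A' u + y *: B' u = u) ->
       exists2 u, u != 0 & x *: A u + y *: B u = u) ->
    (forall v, iter k (A \o B) v = v) ->
  forall v, iter k (A' \o B') v = v.
Proof.
move=> AK BK AK' BK' N_gt0 ABN spec ABk.
apply: iter_eq1_of_eigenvalues N_gt0 ABN _ => z v v_neq0 /= ABv.
have z_neq0 : z != 0.
  apply: contraNneq v_neq0 => z0; move: ABv; rewrite z0 scale0r => ABv.
  by rewrite -[v]BK' -[B' v]AK' ABv !linear0.
have [y y_neq0 zy] := conic_point (z + z^-1).
have [e e1 fixed'] := fixed_vector_of_eigenvector AK' BK' z_neq0 v_neq0 ABv zy.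
have e_neq0 : e != 0.
  by case/orP: e1 => /eqP ->; rewrite ?oppr_eq0 oner_eq0.
have ee : e ^+ 2 = 1 by case/orP: e1 => /eqP ->; rewrite ?sqrrN expr1n.
have {fixed'} [u u_neq0 fix_u] := spec _ _ fixed'.
have zy' : (e * 2) ^+ 2 + (e * y) ^+ 2 - 1 + e * 2 * (e * y) * (z + z^-1) = 0.
  rewrite -zy (_ : _ * (e * y) = e ^+ 2 * (2 * y)); last by ring.
  by rewrite !exprMn ee !mul1r.
have e2_neq0 : e * 2 != 0 by rewrite mulf_neq0 ?pnatr_eq0.
have ey_neq0 : e * y != 0 by rewrite mulf_neq0.
have [w w_neq0 ABw] :=
  eigenvector_of_fixed_vector AK BK z_neq0 e2_neq0 ey_neq0 u_neq0 fix_u zy'.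
have powE c : A (B w) = c *: w -> c ^+ k = 1.
  move=> cw; apply/eqP; rewrite -subr_eq0; have := w_neq0.
  apply: contraNT => ck; rewrite -(inj_eq (scalerI ck)) scaler0 scalerBl scale1r.
  by rewrite -(iter_eigenvector (A \o B) k cw) ABk subrr.
by case: ABw => /powE //; rewrite exprVn => /(canRL invrK); rewrite invr1.
Qed.

Lemma proper_joint_spectrumP {K : fieldType} {V : vectType K} {n : nat}
    (A : 'I_n -> 'End(V)) (x : 'rV[K]_n) :
  proper_joint_spectrum A x <->
  exists2 u, u != 0 & \sum_i x 0 i *: A i u = u.
Proof.
rewrite /proper_joint_spectrum /=; set f := _ + _.
have fE u : f u = \sum_i x 0 i *: A i u - u.
  rewrite add_lfunE opp_lfunE id_lfunE sum_lfunE addrC; congr (_ - _).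
  by apply: eq_bigr => i _; rewrite scale_lfunE.
split=> [not_inv | [u u_neq0 fix_u] [g [_ gf]]]; last first.
  case/eqP: u_neq0; rewrite -[u]id_lfunE -gf comp_lfunE fE fix_u subrr.
  exact: linear0.
have [ker0 | ker_neq0] := eqVneq (lker f) 0%VS.
  case: not_inv; exists (f^-1)%VF; move/eqP: ker0 => ker0.
  by rewrite lker0_compfV ?lker0_compVf.
exists (vpick (lker f)); first by rewrite vpick0.
by apply/eqP; rewrite -subr_eq0 -fE -memv_ker memv_pick.
Qed.

Lemma proper_joint_spectrum_pair {K : fieldType} {V : vectType K} {n : nat}
    (A : 'I_n -> 'End(V)) (i j : 'I_n) (x y : K) :
  proper_joint_spectrum A (x *: delta_mx 0 i + y *: delta_mx 0 j) <->
  exists2 u, u != 0 & x *: A i u + y *: A j u = u.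
Proof.
have sumE u : \sum_k (x *: delta_mx 0 i + y *: delta_mx 0 j : 'rV_n) 0 k *: A k u
    = x *: A i u + y *: A j u.
  have pick (c : K) (l : 'I_n) :
      \sum_k (c *: delta_mx 0 l : 'rV_n) 0 k *: A k u = c *: A l u.
    rewrite (bigD1 l) //= big1 => [|k k_neq_l]; rewrite !mxE eqxx /=.
      by rewrite eqxx mulr1 addr0.
    by rewrite (negPf k_neq_l) mulr0 scale0r.
  rewrite -!pick -big_split /=; apply: eq_bigr => k _.
  by rewrite mxE scalerDl.
rewrite proper_joint_spectrumP.
by split=> -[u u_neq0 fix_u]; exists u; rewrite // -[RHS]fix_u sumE.
Qed.

(** * The reflection representation of a Coxeter group *)

Section Reflections.
Context {K : numClosedFieldType} {n : nat} (c : 'M[K]_n).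
Implicit Types (i j : 'I_n) (v : 'rV[K]_n) (w : group_word 'I_n).

Local Notation e i := (delta_mx 0 i : 'rV[K]_n).

Definition reflection i v : 'rV[K]_n := v - (v *m c^T) 0 i *: e i.

Lemma reflection_linear i : linear (reflection i).
Proof.
move=> a u v; rewrite /reflection mulmxDl -scalemxAl !mxE scalerDl opprD addrACA.
by rewrite scalerBr scalerA.
Qed.

HB.instance Definition _ i :=
  GRing.isLinear.Build K 'rV[K]_n 'rV[K]_n *:%R (reflection i)
    (reflection_linear i).

Lemma reflection_delta i j : reflection i (e j) = e j - c i j *: e i.
Proof. by rewrite /reflection -rowE !mxE. Qed.

Lemma reflectionK i : c i i = 2 -> involutive (reflection i).
Proof.
move=> cii v; rewrite {2}/reflection linearB linearZ /= reflection_delta cii.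
rewrite /reflection scalerBr scalerA mulr2n mulrDr mulr1 scalerDl.
by rewrite opprB addrK subrK.
Qed.

(** The letters [x] and [x^-1] act alike: with [2] on the diagonal of [c],
reflections are involutions. *)
Definition word_reflection w v : 'rV[K]_n :=
  foldr (fun l => reflection l.1) v w.

Lemma word_reflection_relator i j k v :
  word_reflection (flatten (nseq k [:: (i, false); (j, false)])) v =
  iter k (reflection i \o reflection j) v.
Proof. by elim: k => //= k ->. Qed.

End Reflections.

(** The product [M] of two reflections acts trivially modulo the plane of [e i]
and [e j], and on that plane it has the eigenvectors [z *: e i + e j] and
[e i + e j], of eigenvalues [z] and [z^-1]. They span the plane as [z != 1], even
when [z = -1]. *)
Section PlaneRotation.
Context {K : numClosedFieldType} {n : nat} (c : 'M[K]_n).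
Variables (i j : 'I_n) (z : K).
Hypotheses (cii : c i i = 2) (cjj : c j j = 2).
Hypotheses (cij : c i j = - (1 + z)) (cji : c j i = - (1 + z^-1)).
Hypotheses (z_neq0 : z != 0) (z_neq1 : z != 1).

Local Notation e i := (delta_mx 0 i : 'rV[K]_n).
Local Notation M := (reflection c i \o reflection c j).

Let Mi : reflection c i (reflection c j (e i)) = (1 + z + z^-1) *: e i + (1 + z^-1) *: e j.
Proof.
rewrite reflection_delta linearB linearZ /= !reflection_delta cii cij cji.
by apply/rowP => h; rewrite !mxE; field.
Qed.

Let Mj : reflection c i (reflection c j (e j)) = - (1 + z) *: e i - e j.
Proof.
rewrite reflection_delta linearB linearZ /= !reflection_delta cjj cij.
by apply/rowP => h; rewrite !mxE; ring.
Qed.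

Lemma rotation_eigenvector : M (z *: e i + e j) = z *: (z *: e i + e j).
Proof. by rewrite linearD linearZ /= Mi Mj; apply/rowP => h; rewrite !mxE; field. Qed.

Lemma rotation_eigenvectorV : M (e i + e j) = z^-1 *: (e i + e j).
Proof. by rewrite linearD /= Mi Mj; apply/rowP => h; rewrite !mxE; field. Qed.

Lemma rotation_shift v :
  exists p q, M v = v + (p *: (z *: e i + e j) + q *: (e i + e j)).
Proof.
(* [a] and [b] are the coordinates of [M v - v] on [e i] and [e j]. *)
pose b := - (v *m c^T) 0 j; pose a := - (v *m c^T) 0 i - b * c i j.
exists ((a - b) / (z - 1)), ((z * b - a) / (z - 1)).
have -> : M v = v + (a *: e i + b *: e j).
  rewrite /= {2}/reflection linearB linearZ /= reflection_delta {1}/reflection.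
  rewrite /a /b; set p := _ 0 i; set q := _ 0 j.
  by apply/rowP => h; rewrite !mxE; ring.
by apply/rowP => h; rewrite !mxE; field; rewrite subr_eq0.
Qed.

(** The iterates of [M] add to [v] geometric sums of the powers of [z] and
[z^-1] along the two eigenvectors, and these sums vanish when [z ^ k = 1]. *)
Lemma rotation_order k : z ^+ k = 1 -> forall v, iter k M v = v.
Proof.
move=> zk1 v; have [p [q Mv]] := rotation_shift v.
have := rotation_eigenvector; have := rotation_eigenvectorV.
set a := z *: _ + _ in Mv *; set b := e i + e j in Mv *.
move: a b Mv => a b /= Mv Mb Ma.
have ME (L : {linear 'rV[K]_n -> 'rV[K]_n}) x y :
    L (v + (x *: a + y *: b)) = L v + (x *: L a + y *: L b).
  by rewrite !linearD !linearZ_LR.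
have step l : iter l M v =
    v + ((p * \sum_(h < l) z ^+ h) *: a + (q * \sum_(h < l) z^-1 ^+ h) *: b).
  elim: l => [|l IHl]; first by rewrite !big_ord0 !mulr0 !scale0r !addr0.
  have sumS (x : K) : \sum_(h < l.+1) x ^+ h = 1 + (\sum_(h < l) x ^+ h) * x.
    by rewrite big_ord_recl mulr_suml; under eq_bigr => h _ do rewrite exprSr.
  rewrite iterS IHl (ME M) /= Mv Ma Mb !sumS.
  by rewrite !mulrDr !mulr1 !scalerDl !mulrA !scalerA -addrA [X in v + X]addrACA.
rewrite step !geometric_sum_eq0 ?mulr0 ?scale0r ?addr0 //.
  by rewrite exprVn zk1 invr1.
by rewrite invr_eq1.
Qed.

Lemma rotation_faithful k :
  i != j -> (forall v, iter k M v = v) -> z ^+ k = 1.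
Proof.
move=> i_neq_j Mk.
have := iter_eigenvector M k rotation_eigenvector; rewrite Mk.
move/rowP/(_ j); rewrite !mxE !eqxx eq_sym (negPf i_neq_j) /=.
by rewrite mulr0 add0r mulr1.
Qed.

End PlaneRotation.

Lemma word_val_relator {I : Type} {G : groupType} (s : I -> G) (i j : I) k :
  word_val s (flatten (nseq k [:: (i, false); (j, false)])) = ((s i * s j) ^+ k)%g.
Proof.
rewrite /word_val; elim: k => [|k IHk]; first by rewrite big_nil.
by rewrite /= !big_cons IHk expgS mulgA.
Qed.

Lemma coxeter_relation {n : nat} {m : 'M[nat]_n} {W : groupType} {s : 'I_n -> W} :
  coxeter_group m s -> forall i j, ((s i * s j) ^+ m i j = 1)%g.
Proof.
move=> [_ [_ presE]] i j; rewrite -word_val_relator.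
transitivity (word_val s [::]); last by rewrite /word_val big_nil.
apply/presE; rewrite -[flatten _]cats0.
by apply: (@pres_relator _ (coxeter_relator m) [::] [::]); exists i, j.
Qed.

(** The defining relations hold for the reflections of a suitable Cartan matrix,
so the presentation turns a relation of [W] into one between reflections; there
[s i * s j] has an eigenvalue that is a primitive root of unity of order
[m i j]. *)
Lemma coxeter_relation_dvd {n : nat} {m : 'M[nat]_n} {W : groupType}
    {s : 'I_n -> W} {i j : 'I_n} {k : nat} :
  coxeter_group m s -> i != j -> ((s i * s j) ^+ k = 1)%g -> (m i j %| k)%N.
Proof.
move=> [[m_sym m_diag m_gt1] [_ presE]] i_neq_j.
have m_gt0 a b : (0 < m a b)%N.
  by have [->|/m_gt1/ltnW//] := eqVneq a b; rewrite m_diag.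
pose zeta a b : algC := sval (C_prim_root_exists (m_gt0 a b)).
have zeta_prim a b : (m a b).-primitive_root (zeta a b).
  exact: svalP (C_prim_root_exists (m_gt0 a b)).
(* The two orders of a pair must carry mutually inverse roots of unity. *)
pose z (a b : 'I_n) := if (a < b)%N then zeta a b else (zeta b a)^-1.
have zX a b l : (z a b ^+ l == 1) = (m a b %| l)%N.
  rewrite /z; case: ifP => _; first by rewrite -(prim_order_dvd (zeta_prim _ _)).
  by rewrite exprVn invr_eq1 -(prim_order_dvd (zeta_prim _ _)) m_sym.
have zV a b : a != b -> z b a = (z a b)^-1.
  by rewrite -val_eqE /z; case: ltngtP; rewrite ?invrK.
have z_neq0 a b : z a b != 0.
  have := zX a b (m a b); rewrite dvdnn; apply: contraTneq => ->.
  by rewrite expr0n gtn_eqF // eq_sym oner_eq0.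
have z_neq1 a b : a != b -> z a b != 1.
  by move=> /m_gt1; rewrite -[z a b]expr1 zX dvdn1; case: (m a b) => [|[]].
pose c : 'M[algC]_n := \matrix_(a, b) if a == b then 2 else - (1 + z a b).
have cd a : c a a = 2 by rewrite mxE eqxx.
have cE a b : a != b -> c a b = - (1 + z a b) by rewrite mxE => /negPf ->.
have cEV a b : a != b -> c b a = - (1 + (z a b)^-1).
  by move=> ab; rewrite cE 1?eq_sym // zV.
have act_cat u w v : word_reflection c (u ++ w) v =
    word_reflection c u (word_reflection c w v) by rewrite /word_reflection foldr_cat.
have act_eq u w : pres_eq (coxeter_relator m) u w ->
    word_reflection c u =1 word_reflection c w.
  elim=> {u w} //.
  - by move=> u w _ uw v.
  - by move=> u1 u2 u3 _ u12 _ u23 v; rewrite u12.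
  - by move=> u w a b v; rewrite !act_cat /= reflectionK.
  move=> u w _ [a [b ->]] v; rewrite !act_cat word_reflection_relator.
  congr word_reflection; have [-> | a_neq_b] := eqVneq a b.
    by rewrite m_diag /= reflectionK.
  apply: (rotation_order c a b (z a b)); rewrite ?z_neq0 ?z_neq1 //;
    [exact: cE | exact: cEV |].
  by apply/eqP; rewrite zX.
move=> sk1; have : word_val s (flatten (nseq k [:: (i, false); (j, false)])) =
    word_val s [::] by rewrite word_val_relator sk1 /word_val big_nil.
move/presE/act_eq => act1; rewrite -zX; apply/eqP.
apply: (rotation_faithful c i j) => //; [exact: cE | exact: cEV |].
by move=> v; rewrite -word_reflection_relator act1.
Qed.

(** * Comparing two Coxeter groups *)

Lemma representation_involutive {K : fieldType} {V : vectType K} {G : groupType}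
    {rho : G -> 'End(V)} {g : G} :
  representation rho -> (g * g = 1)%g -> involutive (rho g).
Proof. by move=> [rho1 rhoM] gg v; rewrite -comp_lfunE -rhoM gg rho1 id_lfunE. Qed.

Lemma iter_representation {K : fieldType} {V : vectType K} {G : groupType}
    {rho : G -> 'End(V)} (g h : G) (k : nat) (v : V) :
  representation rho -> iter k (rho g \o rho h) v = rho ((g * h) ^+ k)%g v.
Proof.
move=> [rho1 rhoM]; elim: k => [|k IHk]; first by rewrite rho1 id_lfunE.
by rewrite iterS IHk expgS !rhoM !comp_lfunE.
Qed.

Lemma coxeter_entry_dvd {K : numClosedFieldType} {n : nat}
    {m m' : 'M[nat]_n} {W W' : groupType} {s : 'I_n -> W} {s' : 'I_n -> W'}
    {V V' : vectType K} {rho : W -> 'End(V)} {rho' : W' -> 'End(V')} (i j : 'I_n) :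
    coxeter_group m s -> coxeter_group m' s' ->
    representation rho -> faithful_representation rho' ->
    (proper_joint_spectrum (fun i => rho' (s' i)) `<=`
     proper_joint_spectrum (fun i => rho (s i)))%classic ->
  i != j -> (m' i j %| m i j)%N.
Proof.
move=> cox cox' rep [rep' inj_rho'] sub_spec i_neq_j.
have invol (m0 : 'M[nat]_n) (W0 : groupType) (s0 : 'I_n -> W0) a :
    coxeter_group m0 s0 -> (s0 a * s0 a = 1)%g.
  by move=> cox0; have := coxeter_relation cox0 a a; case: cox0 => -[_ -> _] _.
apply: (coxeter_relation_dvd cox' i_neq_j); apply: inj_rho'; apply/lfunP => v.
rewrite -iter_representation //; have [-> _] := rep'; rewrite id_lfunE.
have m'_gt0 : (0 < m' i j)%N by case: cox' => -[_ _ /(_ i j i_neq_j)/ltnW].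
apply: (iter_eq1_of_fixed_vectors (A := rho (s i)) (B := rho (s j)) _ _ _ _ m'_gt0).
- exact: representation_involutive rep (invol _ _ _ _ cox).
- exact: representation_involutive rep (invol _ _ _ _ cox).
- exact: representation_involutive rep' (invol _ _ _ _ cox').
- exact: representation_involutive rep' (invol _ _ _ _ cox').
- move=> u; rewrite iter_representation // coxeter_relation //.
  by case: rep' => -> _; rewrite id_lfunE.
- move=> x y /(proper_joint_spectrum_pair (fun i => rho' (s' i)))/sub_spec.
  by move/proper_joint_spectrum_pair.
move=> u; rewrite iter_representation // coxeter_relation //.
by case: rep => -> _; rewrite id_lfunE.
Qed.

Theorem theorem5p1 (R : realType) (n : nat) (hn : (0 < n)%N)
    (m : 'M[nat]_n) (W : groupType) (s : 'I_n -> W)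
    (hW : coxeter_group m s)
    (V : vectType R[i]) (rho : W -> 'End(V))
    (hrho : faithful_representation rho)
    (m' : 'M[nat]_n) (W' : groupType) (s' : 'I_n -> W')
    (hW' : coxeter_group m' s')
    (V' : vectType R[i]) (rho' : W' -> 'End(V'))
    (hrho' : faithful_representation rho')
    (hU : proper_joint_spectrum (fun i => rho' (s' i)) =
          proper_joint_spectrum (fun i => rho (s i))) :
  forall i j : 'I_n, m i j = m' i j.
Proof.
move=> i j; have [<- | i_neq_j] := eqVneq i j.
  by case: hW hW' => -[_ -> _] _ [[_ -> _] _].
apply/eqP; rewrite eqn_dvd; apply/andP; split.
  apply: (coxeter_entry_dvd i j hW' hW (proj1 hrho') hrho) => //.
  by rewrite hU.
apply: (coxeter_entry_dvd i j hW hW' (proj1 hrho) hrho') => //.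
by rewrite hU.
Qed.
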